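(* Let $1<a<b$ be coprime integers. For all $\mathbf{n},\mathbf{n}'\in C_{\mathbb{R}}$ we have $B(\mathbf{n},\mathbf{n}')\ge0$; in particular $Q(\mathbf{n})\ge0$ for $\mathbf{n}\in C_\mathbb{R}$. Moreover, for every $\mathbf{n}\in C_{\mathbb{R}}$, \[ Q(\mathbf{n})\ge \frac{1}{|G|}\,\|\mathbf{n}\|_\infty^2, \] where $\|\mathbf{n}\|_\infty=\max_{i\in G}|n_i|$.
   Context: Fix coprime integers $1<a<b$. Let $g:\mathbb{Z}^2\to\mathbb{Z}$, $g(x,y)=ab-ax-by$, and $G=\{(x,y)\in\mathbb{Z}_{\ge1}^2: g(x,y)>0\}$. Equip $G$ with the partial order $i\preceq j$ iff $g(j)-g(i)\in\{ma+nb: m,n\in\mathbb{Z}_{\ge0}\}$. Let \[ C_{\mathbb{R}}=\{\mathbf{n}=(n_i)_{i\in G}\in\mathbb{R}^G:\ n_i\ge0 \text{ for all } i,\ \ n_j\ge n_i \text{ whenever } i\preceq j\}. \] Define $K(d)=\mathbf{1}_{d\ge0}-\mathbf{1}_{d\ge a}-\mathbf{1}_{d\ge b}+\mathbf{1}_{d\ge a+b}$ for $d\in\mathbb{Z}$, the quadratic form $Q(\mathbf{n})=\sum_{i,j\in G}K(g(j)-g(i))\,n_in_j$ on $\mathbb{R}^G$, and the associated symmetric bilinear form \[ B(\mathbf{n},\mathbf{n}')=\tfrac12\sum_{i,j\in G}K(g(j)-g(i))\,(n_in'_j+n'_in_j), \] so that $B(\mathbf{n},\mathbf{n})=Q(\mathbf{n})$.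 *)

(* Defs.v *)
From mathcomp Require Import all_boot all_order all_algebra.
From mathcomp Require Import reals.
Unset Printing Implicit Defensive.
Import Order.TTheory GRing.Theory Num.Theory.
Local Open Scope ring_scope.

Definition gval (a b : nat) (x y : nat) : int :=
  (a%:Z * b%:Z - a%:Z * x%:Z - b%:Z * y%:Z).

(* points (x,y) of Z_{>=1}^2 with g(x,y) > 0; any such point has x < b, y < a,
   so we carry them in the finite box 'I_b * 'I_a *)
Definition inG (a b : nat) (p : 'I_b * 'I_a) : bool :=
  [&& (0 < (p.1 : nat))%N, (0 < (p.2 : nat))%N & (0 < gval a b p.1 p.2)].

Definition Gtype (a b : nat) := {p : 'I_b * 'I_a | inG a b p}.

Definition gG (a b : nat) (i : Gtype a b) : int :=
  gval a b (val i).1 (val i).2.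

Definition in_semigroup (a b : nat) (d : int) : Prop :=
  exists m n : nat, d = (m * a + n * b)%N%:Z.

Definition precG (a b : nat) (i j : Gtype a b) : Prop :=
  in_semigroup a b (gG a b j - gG a b i)%R.

Definition inCR (R : realType) (a b : nat) (n : Gtype a b -> R) : Prop :=
  (forall i, 0 <= n i) /\ (forall i j, precG a b i j -> n i <= n j).

Definition Kfun (R : realType) (a b : nat) (d : int) : R :=
  ((0 <= d)%R%:R - (a%:Z <= d)%R%:R - (b%:Z <= d)%R%:R + ((a + b)%N%:Z <= d)%R%:R).

Definition Bform (R : realType) (a b : nat) (n n' : Gtype a b -> R) : R :=
  2^-1 * \sum_(i : Gtype a b) \sum_(j : Gtype a b)
     Kfun R a b (gG a b j - gG a b i) * (n i * n' j + n' i * n j).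

Definition Qform (R : realType) (a b : nat) (n : Gtype a b -> R) : R :=
  \sum_(i : Gtype a b) \sum_(j : Gtype a b) Kfun R a b (gG a b j - gG a b i) * (n i * n j).

Definition supnorm (R : realType) (a b : nat) (n : Gtype a b -> R) : R :=
  \big[Num.max/0]_(i : Gtype a b) `|n i|.

(* Main.v *)
(** Write [d = a s + b t] for the difference of the values of [g] at two points
whose coordinates differ by [(s, t)].  The symmetrised kernel [K d + K (- d)]
is the symmetrisation of the mixed difference (in [s] and [t]) of
[- [s >= 0] [- a - b < d < 0]].  Extending [n] by zero to the quadrant and
summing by parts twice therefore gives
[2 B(n, n') = \sum_(p, q) w(p - q) (dx n p dy n' q + dx n' p dy n q)],
where [w(s, t) = [s >= 0] [- a < d < b]] is nonnegative, [w(0, 0) = 1], and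
[dx n], [dy n] are the decrements of [n] in the two coordinate directions, which
are nonnegative on the cone.  The diagonal terms alone yield
[Q n >= \sum_p (m p)^2] with [m = min (dx n) (dy n)].  Following at each
point the larger of the two successors until [n] vanishes, the values of [m]
along the path add up to the starting value of [n], so [|n|_oo <= \sum_p m p],
and the bound follows from Cauchy-Schwarz. *)
Require Import Defs.
From mathcomp Require Import all_boot all_order all_algebra.
From mathcomp Require Import reals.
From mathcomp Require Import zify ring lra.
Import Order.TTheory GRing.Theory Num.Theory.
Local Open Scope ring_scope.

(** * Kernel sums on a square grid and summation by parts *)

Definition dx (R : realType) (f : nat -> nat -> R) (x y : nat) : R :=
  f x y - f x.+1 y.

Definition dy (R : realType) (f : nat -> nat -> R) (x y : nat) : R :=
  f x y - f x y.+1.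

Definition pairsum (R : realType) (M : nat) (k : int -> int -> R)
    (f h : nat -> nat -> R) : R :=
  \sum_(p : 'I_M * 'I_M) \sum_(q : 'I_M * 'I_M)
    k (p.1%:Z - q.1%:Z) (p.2%:Z - q.2%:Z) * (f p.1 p.2 * h q.1 q.2).

Lemma eq_pairsum (R : realType) (M : nat) (k k' : int -> int -> R)
    (f h : nat -> nat -> R) :
  (forall s t, k s t = k' s t) -> pairsum R M k f h = pairsum R M k' f h.
Proof.
by move=> kk'; apply: eq_bigr => p _; apply: eq_bigr => q _; rewrite kk'.
Qed.

Lemma pairsumD (R : realType) (M : nat) (k k' : int -> int -> R)
    (f h : nat -> nat -> R) :
  pairsum R M (fun s t => k s t + k' s t) f h =
  pairsum R M k f h + pairsum R M k' f h.
Proof.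
rewrite -big_split; apply: eq_bigr => p _.
by rewrite -big_split; apply: eq_bigr => q _; rewrite mulrDl.
Qed.

Lemma pairsum_swap (R : realType) (M : nat) (k : int -> int -> R)
    (f h : nat -> nat -> R) :
  pairsum R M k h f = pairsum R M (fun s t => k (- s) (- t)) f h.
Proof.
rewrite /pairsum exchange_big; apply: eq_bigr => p _; apply: eq_bigr => q _.
by rewrite !opprB [h _ _ * _]mulrC.
Qed.

Lemma sum_by_parts (R : realType) (m : nat) (f : nat -> R) (p : int -> R) :
  \sum_(x < m) (p x%:Z - p (x%:Z - 1)) * f x =
  \sum_(x < m) p x%:Z * (f x - f x.+1) + p (m%:Z - 1) * f m - p (- 1) * f 0%N.
Proof.
elim: m => [|m IHm]; first by rewrite !big_ord0 !add0r subrr.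
rewrite !big_ord_recr /= IHm.
have -> : m.+1%:Z - 1 = m%:Z by lia.
ring.
Qed.

(** Abel summation in the first coordinate of [f]: the boundary term at [-1] dies because [k]
    vanishes for [s < 0], the one at [M] because [f] does. *)
Lemma pairsum_dx (R : realType) (M : nat) (k : int -> int -> R)
    (f h : nat -> nat -> R) :
  (forall s t, s < 0 -> k s t = 0) -> (forall y, f M y = 0) ->
  pairsum R M (fun s t => k s t - k (s - 1) t) f h = pairsum R M k (dx R f) h.
Proof.
move=> k0 fM; rewrite /pairsum exchange_big [RHS]exchange_big.
apply: eq_bigr => q _.
rewrite -(pair_bigA _ (fun x y : 'I_M =>
  (k (x%:Z - q.1%:Z) (y%:Z - q.2%:Z) - k (x%:Z - q.1%:Z - 1) (y%:Z - q.2%:Z))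
   * (f x y * h q.1 q.2))).
rewrite -(pair_bigA _ (fun x y : 'I_M =>
  k (x%:Z - q.1%:Z) (y%:Z - q.2%:Z) * (dx R f x y * h q.1 q.2))) /=.
rewrite exchange_big [RHS]exchange_big; apply: eq_bigr => y _ /=.
have := sum_by_parts R M (fun x => f x y * h q.1 q.2)
  (fun s => k (s - q.1%:Z) (y%:Z - q.2%:Z)).
rewrite /= fM mul0r mulr0 addr0 [k (- 1 - _) _]k0; last by lia.
rewrite mul0r subr0 => E.
rewrite [RHS](eq_bigr _ (fun x _ => congr1 _ (mulrBl _ _ _))) -{}E.
by apply: eq_bigr => x _; rewrite [x%:Z - 1 - _]addrAC.
Qed.

(** The summed coordinate [y] of [h] enters the kernel negatively, so the primitive in [y] is
    [- k s (t - 1)]; this explains the sign and the shift. At [y = -1] it is evaluated at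
    [t = p.2 >= 0], where [k] vanishes. *)
Lemma pairsum_dy (R : realType) (M : nat) (k : int -> int -> R)
    (f h : nat -> nat -> R) :
  (forall s t, 0 <= t -> k s t = 0) -> (forall x, h x M = 0) ->
  pairsum R M (fun s t => k s t - k s (t - 1)) f h =
  pairsum R M (fun s t => - k s (t - 1)) f (dy R h).
Proof.
move=> k0 hM; apply: eq_bigr => p _.
rewrite -(pair_bigA _ (fun x y : 'I_M =>
  (k (p.1%:Z - x%:Z) (p.2%:Z - y%:Z) - k (p.1%:Z - x%:Z) (p.2%:Z - y%:Z - 1))
   * (f p.1 p.2 * h x y))).
rewrite -(pair_bigA _ (fun x y : 'I_M =>
  - k (p.1%:Z - x%:Z) (p.2%:Z - y%:Z - 1) * (f p.1 p.2 * dy R h x y))) /=.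
apply: eq_bigr => x _ /=.
have := sum_by_parts R M (fun y => f p.1 p.2 * h x y)
  (fun t => - k (p.1%:Z - x%:Z) (p.2%:Z - t - 1)).
rewrite /= hM !mulr0 addr0 [k _ (_ - - 1 - 1)]k0; last by lia.
rewrite oppr0 mul0r subr0 => E.
rewrite [RHS](eq_bigr _ (fun x _ => congr1 _ (mulrBr _ _ _))) -{}E.
apply: eq_bigr => y _; rewrite opprK addrC.
by have -> : p.2%:Z - (y%:Z - 1) - 1 = p.2%:Z - y%:Z by lia.
Qed.

(** * The symmetrised kernel as a mixed difference *)

Definition step (R : realType) (d : int) : R := (0 <= d)%R%:R.

Lemma stepN (R : realType) (d : int) : step R (- d) = 1 - step R (d - 1).
Proof.
rewrite /step.
have -> : (0 <= - d) = ~~ (0 <= d - 1) by lia.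
by case: (0 <= d - 1); rewrite /= ?subrr ?subr0.
Qed.

Lemma step_le (R : realType) (d e : int) : d <= e -> step R d <= step R e.
Proof.
by rewrite /step ler_nat => de; case: (lerP 0 d) => // d0; rewrite (le_trans d0 de).
Qed.

Lemma KfunE (R : realType) (a b : nat) (d : int) :
  Kfun R a b d =
  step R d - step R (d - a%:Z) - step R (d - b%:Z) + step R (d - a%:Z - b%:Z).
Proof.
rewrite /Kfun /step.
have -> : ((a + b)%N%:Z <= d) = (0 <= d - a%:Z - b%:Z) by lia.
by rewrite !subr_ge0.
Qed.

(* Equal to [- [s >= 0] [- a - b < d < 0]] with [d = a s + b t]; a difference
   of steps makes [Kfun_sym] an identity between steps. *)
Definition potential (R : realType) (a b : nat) (s t : int) : R :=
  step R s * (step R (a%:Z * s + b%:Z * t) -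
              step R (a%:Z * s + b%:Z * t + a%:Z + b%:Z - 1)).

Definition weight (R : realType) (a b : nat) (s t : int) : R :=
  step R s * (step R (a%:Z * s + b%:Z * t + a%:Z - 1) -
              step R (a%:Z * s + b%:Z * t - b%:Z)).

Lemma weightE (R : realType) (a b : nat) (s t : int) :
  weight R a b s t = - potential R a b s (t - 1).
Proof.
rewrite /weight /potential -mulrN opprB; congr (_ * (step R _ - step R _)); lia.
Qed.

Lemma weight_ge0 (R : realType) (a b : nat) (s t : int) :
  (0 < a)%N -> 0 <= weight R a b s t.
Proof.
by move=> a0; rewrite mulr_ge0 ?ler0n// subr_ge0 step_le//; lia.
Qed.

Lemma weight00 (R : realType) (a b : nat) :
  (0 < a)%N -> (0 < b)%N -> weight R a b 0 0 = 1.
Proof.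
move=> a0 b0; rewrite /weight /step !mulr0 lexx mul1r.
have -> : (0 <= 0 + 0 + a%:Z - 1) = true by lia.
have -> : (0 <= 0 + 0 - b%:Z) = false by lia.
by rewrite subr0.
Qed.

Definition mixed (R : realType) (k : int -> int -> R) (s t : int) : R :=
  (k s t - k (s - 1) t) - (k s (t - 1) - k (s - 1) (t - 1)).

(** The second factor of [potential], as a function of [d], is invariant under [d -> - a - b - d],
    so reflection permutes the four terms of the mixed difference. It turns [step s] and
    [step (s - 1)] into their complements to 1, hence these cancel in the sum and only steps in [d]
    remain. *)
Lemma Kfun_sym (R : realType) (a b : nat) (s t : int) :
  Kfun R a b (a%:Z * s + b%:Z * t) + Kfun R a b (a%:Z * (- s) + b%:Z * (- t)) =
  mixed R (potential R a b) s t + mixed R (potential R a b) (- s) (- t).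
Proof.
rewrite !KfunE /mixed /potential.
set A := a%:Z; set B := b%:Z; set d := A * s + B * t.
(* Reflected arguments are brought to the form [- _], so that [stepN] leaves the same atoms on both
   sides. *)
have -> : A * - s + B * - t = - d by rewrite /d; ring.
have -> : A * (s - 1) + B * t = d - A by rewrite /d; ring.
have -> : A * s + B * (t - 1) = d - B by rewrite /d; ring.
have -> : A * (s - 1) + B * (t - 1) = d - A - B by rewrite /d; ring.
have -> : A * (- s - 1) + B * (- t) = - (d + A) by rewrite /d; ring.
have -> : A * (- s) + B * (- t - 1) = - (d + B) by rewrite /d; ring.
have -> : A * (- s - 1) + B * (- t - 1) = - (d + A + B) by rewrite /d; ring.
have -> : - s - 1 = - (s + 1) by ring.
have -> : - d - A = - (d + A) :> int by ring.
have -> : - d - B = - (d + B) by ring.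
have -> : - (d + A) - B = - (d + A + B) by ring.
have -> : - d + A + B - 1 = - (d - A - B + 1) by ring.
have -> : - (d + A) + A + B - 1 = - (d - B + 1) by ring.
have -> : - (d + B) + A + B - 1 = - (d - A + 1) by ring.
have -> : - (d + A + B) + A + B - 1 = - (d + 1) by ring.
rewrite !stepN !addrK.
have -> : d - A + A + B - 1 = d + B - 1 by ring.
have -> : d - B + A + B - 1 = d + A - 1 by ring.
have -> : d - A - B + A + B - 1 = d - 1 by ring.
ring.
Qed.

Lemma pairsum_sym (R : realType) (a b M : nat) (f h : nat -> nat -> R) :
  (0 < a)%N -> (forall y, f M y = 0) -> (forall x, f x M = 0) ->
  (forall y, h M y = 0) -> (forall x, h x M = 0) ->
  pairsum R M (fun s t => Kfun R a b (a%:Z * s + b%:Z * t)) f h +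
  pairsum R M (fun s t => Kfun R a b (a%:Z * s + b%:Z * t)) h f =
  pairsum R M (weight R a b) (dx R f) (dy R h) +
  pairsum R M (weight R a b) (dx R h) (dy R f).
Proof.
move=> a0.
have parts f' h' : (forall y, f' M y = 0) -> (forall x, h' x M = 0) ->
    pairsum R M (mixed R (potential R a b)) f' h' =
    pairsum R M (weight R a b) (dx R f') (dy R h').
  move=> f0 h0.
  have negx s t : s < 0 -> potential R a b s t = 0.
    by move=> s0; rewrite /potential /step (lt_geF s0) mul0r.
  have post s t : 0 <= t -> potential R a b s t = 0.
    move=> t0; case: (ltrP s 0) => [/negx//|s0].
    have d0 : 0 <= a%:Z * s + b%:Z * t by rewrite addr_ge0// mulr_ge0.
    rewrite /potential /step d0.
    have -> : 0 <= a%:Z * s + b%:Z * t + a%:Z + b%:Z - 1 by lia.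
    by rewrite subrr mulr0.
  rewrite (pairsum_dy R M
    (fun s t => potential R a b s t - potential R a b (s - 1) t)) //; last first.
    by move=> s t t0; rewrite !post// subrr.
  rewrite (eq_pairsum R M _
    (fun s t => weight R a b s t - weight R a b (s - 1) t)); last first.
    by move=> s t; rewrite !weightE; ring.
  rewrite pairsum_dx// => s t s0.
  by rewrite weightE negx ?oppr0.
move=> f1 f2 h1 h2; rewrite -!parts//.
(* Exchanging [f] and [h] reflects the kernel, so only symmetrised kernels have to agree. *)
rewrite [pairsum _ _ _ h f]pairsum_swap.
rewrite [pairsum _ _ (mixed _ _) h f]pairsum_swap -!pairsumD.
by apply: eq_pairsum => s t; rewrite Kfun_sym.
Qed.

Lemma le_diagonal_weight (R : realType) (a b M : nat) (F H : nat -> nat -> R) :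
  (0 < a)%N -> (0 < b)%N ->
  (forall x y, 0 <= F x y) -> (forall x y, 0 <= H x y) ->
  \sum_(p : 'I_M * 'I_M) F p.1 p.2 * H p.1 p.2 <= pairsum R M (weight R a b) F H.
Proof.
move=> a0 b0 F0 H0; apply: ler_sum => p _.
rewrite (bigD1 p)//= !subrr weight00// mul1r lerDl.
apply: sumr_ge0 => q _; apply: mulr_ge0; first exact: weight_ge0.
exact: mulr_ge0.
Qed.

(** * Extension by zero from [G] to the grid *)

Lemma gvalSl (a b x y : nat) : gval a b x.+1 y = gval a b x y - a%:Z.
Proof. by rewrite /gval intS; ring. Qed.

Lemma gvalSr (a b x y : nat) : gval a b x y.+1 = gval a b x y - b%:Z.
Proof. by rewrite /gval intS; ring. Qed.

(* The coordinates are shifted so that the grid starts at (0, 0); points outside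
   [G] get the empty sum 0. *)
Definition extend (R : realType) (a b : nat) (n : Gtype a b -> R) (x y : nat) : R :=
  \sum_(i : Gtype a b | ((val i).1 == x.+1 :> nat) && ((val i).2 == y.+1 :> nat)) n i.

Lemma extendE (R : realType) (a b : nat) (n : Gtype a b -> R) (i : Gtype a b) :
  extend R a b n (val i).1.-1 (val i).2.-1 = n i.
Proof.
have /and3P[x0 y0 _] := valP i.
by rewrite /extend !prednK// (big_pred1 i).
Qed.

Lemma extendP (R : realType) (a b : nat) (n : Gtype a b -> R) (x y : nat) :
  (exists i : Gtype a b, [/\ (val i).1 = x.+1 :> nat, (val i).2 = y.+1 :> nat
                           & extend R a b n x y = n i]) \/
  (forall i : Gtype a b, (val i).1 = x.+1 :> nat -> (val i).2 = y.+1 :> nat -> False) /\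
  extend R a b n x y = 0.
Proof.
case: (pickP (fun i : Gtype a b =>
  ((val i).1 == x.+1 :> nat) && ((val i).2 == y.+1 :> nat))) => [i|none].
  case/andP => /eqP ix /eqP iy; left; exists i; split=> //.
  by rewrite -(extendE R a b n i) ix iy.
right; split; last by rewrite /extend big_pred0.
by move=> i ix iy; have := none i; rewrite ix iy !eqxx.
Qed.

Lemma sum_extend (R : realType) (a b M : nat) (n : Gtype a b -> R)
    (F : nat -> nat -> R) :
  (a <= M)%N -> (b <= M)%N ->
  \sum_(i : Gtype a b) F (val i).1.-1 (val i).2.-1 * n i =
  \sum_(p : 'I_M * 'I_M) F p.1 p.2 * extend R a b n p.1 p.2.
Proof.
move=> aM bM; under [RHS]eq_bigr do rewrite /extend mulr_sumr big_mkcond /=.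
rewrite exchange_big; apply: eq_bigr => i _ /=.
have /and3P[x0 y0 _] := valP i.
have xM : ((val i).1.-1 < M)%N by have := ltn_ord (val i).1; lia.
have yM : ((val i).2.-1 < M)%N by have := ltn_ord (val i).2; lia.
rewrite -big_mkcond (big_pred1 (Ordinal xM, Ordinal yM))// => -[x y] /=.
by rewrite -pair_eqE /pair_eq -!val_eqE; move: x0 y0 => /=; lia.
Qed.

Lemma extend_out (R : realType) (a b : nat) (n : Gtype a b -> R) (x y : nat) :
  (b <= x.+1)%N || (a <= y.+1)%N -> extend R a b n x y = 0.
Proof.
move=> out; have [[i [ix iy _]]|[]//] := extendP R a b n x y.
by have := ltn_ord (val i).1; have := ltn_ord (val i).2; lia.
Qed.

Lemma extend_ge0 (R : realType) (a b : nat) (n : Gtype a b -> R) (x y : nat) :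
  inCR R a b n -> 0 <= extend R a b n x y.
Proof. by move=> [n0 _]; apply: sumr_ge0. Qed.

(** [G] is closed under decreasing a coordinate while it stays positive, and such a move raises [g]
    by [a], hence goes up in the order. Outside [G] the successor contributes 0. *)
Lemma dx_extend_ge0 (R : realType) (a b : nat) (n : Gtype a b -> R) (x y : nat) :
  inCR R a b n -> 0 <= dx R (extend R a b n) x y.
Proof.
move=> Cn; rewrite subr_ge0.
have [[i [ix iy ->]]|[_ ->]] := extendP R a b n x.+1 y; last exact: extend_ge0.
have [[j [jx jy ->]]|[none _]] := extendP R a b n x y.
  apply: Cn.2; exists 1%N, 0%N; rewrite /gG ix iy jx jy !gvalSl; lia.
have /and3P[_ y0 gi] := valP i.
have xb : (x.+1 < b)%N by have := ltn_ord (val i).1; lia.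
have jG : inG a b (Ordinal xb, (val i).2).
  rewrite /inG /= y0; apply: (@le_lt_trans _ _ a%:Z) => //.
  by rewrite -subr_gt0 -gvalSl -ix.
by case: (none (exist (fun p => is_true (inG a b p)) _ jG)).
Qed.

Lemma dy_extend_ge0 (R : realType) (a b : nat) (n : Gtype a b -> R) (x y : nat) :
  inCR R a b n -> 0 <= dy R (extend R a b n) x y.
Proof.
move=> Cn; rewrite subr_ge0.
have [[i [ix iy ->]]|[_ ->]] := extendP R a b n x y.+1; last exact: extend_ge0.
have [[j [jx jy ->]]|[none _]] := extendP R a b n x y.
  apply: Cn.2; exists 0%N, 1%N; rewrite /gG ix iy jx jy !gvalSr; lia.
have /and3P[x0 _ gi] := valP i.
have ya : (y.+1 < a)%N by have := ltn_ord (val i).2; lia.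
have jG : inG a b ((val i).1, Ordinal ya).
  rewrite /inG /= x0; apply: (@le_lt_trans _ _ b%:Z) => //.
  by rewrite -subr_gt0 -gvalSr -iy.
by case: (none (exist (fun p => is_true (inG a b p)) _ jG)).
Qed.

Lemma pairsum_extend (R : realType) (a b M : nat) (n n' : Gtype a b -> R) :
  (a <= M)%N -> (b <= M)%N ->
  \sum_(i : Gtype a b) \sum_(j : Gtype a b)
    Kfun R a b (gG a b j - gG a b i) * (n i * n' j) =
  pairsum R M (fun s t => Kfun R a b (a%:Z * s + b%:Z * t))
    (extend R a b n) (extend R a b n').
Proof.
move=> aM bM; rewrite /pairsum.
pose K (x y x' y' : nat) :=
  Kfun R a b (a%:Z * (x%:Z - x'%:Z) + b%:Z * (y%:Z - y'%:Z)).
pose F x y := \sum_(q : 'I_M * 'I_M) K x y q.1 q.2 * extend R a b n' q.1 q.2.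
transitivity (\sum_(i : Gtype a b) F (val i).1.-1 (val i).2.-1 * n i).
  apply: eq_bigr => i _.
  rewrite /F -(sum_extend R a b M n' (K _ _))// mulr_suml; apply: eq_bigr => j _.
  rewrite -mulrA [n' j * _]mulrC /K; congr (Kfun R a b _ * _).
  have /and3P[x0 y0 _] := valP i; have /and3P[x0' y0' _] := valP j.
  (* Since [g] decreases in both coordinates, [g j - g i] is a combination of the coordinates of [i]
     minus those of [j]; the shift by one cancels. *)
  rewrite /gG -[X in gval a b X](prednK x0') -[X in gval a b _ X](prednK y0').
  rewrite -[X in _ - gval a b X _](prednK x0) -[X in _ - gval a b _ X](prednK y0).
  rewrite /gval !intS; ring.
rewrite (sum_extend R a b M)//; apply: eq_bigr => p _.
rewrite mulr_suml; apply: eq_bigr => q _.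
by rewrite -mulrA [extend _ _ _ n' _ _ * _]mulrC.
Qed.

(** * Bounding the sup norm by corner decrements *)

Definition corner (R : realType) (f : nat -> nat -> R) (x y : nat) : R :=
  Num.min (dx R f x y) (dy R f x y).

Lemma le_sum_corner (R : realType) (a b : nat) (n : Gtype a b -> R) (x y : nat) :
  inCR R a b n ->
  extend R a b n x y <=
  \sum_(i : Gtype a b) corner R (extend R a b n) (val i).1.-1 (val i).2.-1.
Proof.
move=> Cn; set m := corner R _.
have m0 u v : 0 <= m u v.
  by rewrite /m /corner le_min dx_extend_ge0// dy_extend_ge0.
(* Only points on the antidiagonal of [(u, v)] or beyond are summed, so no point is counted twice;
   [k] bounds the number of antidiagonals left before the extension vanishes. *)
suff S k u v : (a + b <= u + v + k)%N -> extend R a b n u v <=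
    \sum_(i : Gtype a b | (u + v <= (val i).1.-1 + (val i).2.-1)%N)
      m (val i).1.-1 (val i).2.-1.
  apply: (le_trans (S (a + b)%N x y _)); first by lia.
  by rewrite [leRHS](bigID (fun i : Gtype a b =>
    (x + y <= (val i).1.-1 + (val i).2.-1)%N)) /= lerDl sumr_ge0.
elim: k u v => [|k IHk] u v uvk.
  by rewrite extend_out ?sumr_ge0//; lia.
have [[i [iu iv _]]|[_ ->]] := extendP R a b n u v; last exact: sumr_ge0.
rewrite (bigD1 i) ?iu ?iv//=.
set T := \sum_(_ | _) _.
(* Both successors are bounded by the sum without [i]; the larger one plus the corner term at [i] is
   the value at [(u, v)]. *)
have leT w z : (w + z = (u + v).+1)%N -> extend R a b n w z <= T.
  move=> wz; apply: (le_trans (IHk w z _)); first by lia.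
  rewrite /T big_mkcond [leRHS]big_mkcond; apply: ler_sum => j _.
  case: ifP => // le_wz; case: ifP => //.
  move/negbT; rewrite negb_and negbK => /orP[nle|/eqP ji]; exfalso.
    by move: nle le_wz => /=; lia.
  by move: le_wz; rewrite ji iu iv /=; lia.
have Tx := leT u.+1 v (addSn _ _); have Ty := leT u v.+1 (addnS _ _).
rewrite /m /corner /dx /dy.
by rewrite -lerBlDr le_min; apply/andP; split; lra.
Qed.

Lemma sqr_sum_le (R : realType) (T : finType) (m : T -> R) :
  (\sum_i m i) ^+ 2 <= #|T|%:R * \sum_i m i ^+ 2.
Proof.
have E : \sum_(i : T) \sum_(j : T) (m i ^+ 2 + m j ^+ 2) =
    2 * (#|T|%:R * \sum_i m i ^+ 2).
  under eq_bigr do rewrite big_split /= sumr_const.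
  by rewrite big_split /= sumr_const sumrMnl mulr_natl [in RHS]mulr_natl mulr2n.
(* Doubling reduces the claim to [2 * m i * m j <= m i ^+ 2 + m j ^+ 2] for each pair. *)
rewrite -(ler_pM2l (ltr0Sn R 1)) -E expr2 mulr_suml mulr_sumr.
apply: ler_sum => i _; rewrite !mulr_sumr; apply: ler_sum => j _.
have := sqr_ge0 (m i - m j); nra.
Qed.

Theorem theorem1p3 (R : realType) (a b : nat) :
  (1 < a)%N -> (a < b)%N -> coprime a b ->
  (forall n n' : Gtype a b -> R, inCR R a b n -> inCR R a b n' -> 0 <= Bform R a b n n') /\
  (forall n : Gtype a b -> R, inCR R a b n -> 0 <= Qform R a b n) /\
  (forall n : Gtype a b -> R, inCR R a b n ->
      (#|{: Gtype a b}|%:R)^-1 * (supnorm R a b n) ^+ 2 <= Qform R a b n).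
Proof.
move=> a1 ab _.
have a0 : (0 < a)%N by lia.
have b0 : (0 < b)%N by lia.
have ab' := ltnW ab.
(* Side [b] suffices for the grid, as [a < b]. *)
pose W (n n' : Gtype a b -> R) :=
  pairsum R b (weight R a b) (dx R (extend R a b n)) (dy R (extend R a b n')).
pose diag (n n' : Gtype a b -> R) := \sum_(p : 'I_b * 'I_b)
  dx R (extend R a b n) p.1 p.2 * dy R (extend R a b n') p.1 p.2.
have diagW n n' : inCR R a b n -> inCR R a b n' -> diag n n' <= W n n'.
  move=> Cn Cn'; apply: le_diagonal_weight => // x y.
    exact: dx_extend_ge0.
  exact: dy_extend_ge0.
have diag0 n n' : inCR R a b n -> inCR R a b n' -> 0 <= diag n n'.
  move=> Cn Cn'; apply: sumr_ge0 => p _.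
  by rewrite mulr_ge0 ?dx_extend_ge0 ?dy_extend_ge0.
have BW n n' : Bform R a b n n' = 2^-1 * (W n n' + W n' n).
  rewrite /Bform /W -pairsum_sym //; try by move=> x; apply: extend_out; lia.
  rewrite -!pairsum_extend// -big_split; congr (_ * _); apply: eq_bigr => i _ /=.
  rewrite -big_split; apply: eq_bigr => j _ /=.
  by rewrite mulrDr.
have QB n : Qform R a b n = Bform R a b n n.
  rewrite /Bform mulr_sumr; apply: eq_bigr => i _; rewrite mulr_sumr.
  by apply: eq_bigr => j _; lra.
have B0 n n' : inCR R a b n -> inCR R a b n' -> 0 <= Bform R a b n n'.
  move=> Cn Cn'; rewrite BW mulr_ge0 ?invr_ge0 ?ler0n// addr_ge0//.
    exact: le_trans (diag0 _ _ Cn Cn') (diagW _ _ Cn Cn').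
  exact: le_trans (diag0 _ _ Cn' Cn) (diagW _ _ Cn' Cn).
split; first exact: B0.
split=> n Cn; first by rewrite QB B0.
have leQ : diag n n <= Qform R a b n.
  by rewrite QB BW; have := diagW n n Cn Cn; lra.
pose f := extend R a b n.
pose m (i : Gtype a b) := corner R f (val i).1.-1 (val i).2.-1.
have m0 x y : 0 <= corner R f x y.
  by rewrite /corner le_min dx_extend_ge0// dy_extend_ge0.
have m2 : \sum_i m i ^+ 2 <= diag n n.
  (* The extension of the constant 1 is the indicator of [G]; it turns the sum over [G] into one
     over the grid. *)
  have ext1 x y : extend R a b (fun=> 1) x y <= 1.
    by have [[i [_ _ ->]]|[_ ->]] := extendP R a b (fun=> 1) x y.
  have := sum_extend R a b b (fun=> 1) (fun x y => corner R f x y ^+ 2)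
    ab' (leqnn b).
  under eq_bigr do rewrite mulr1.
  rewrite /m => ->; apply: ler_sum => p _.
  apply: (@le_trans _ _ (corner R f p.1 p.2 ^+ 2)).
    by rewrite ler_piMr// sqr_ge0.
  by rewrite expr2 ler_pM// /corner ge_min lexx ?orbT.
have sum0 : 0 <= \sum_i m i by apply: sumr_ge0 => i _; exact: m0.
have sup : supnorm R a b n <= \sum_i m i.
  apply: bigmax_le => // i _.
  by rewrite ger0_norm ?Cn.1// -(extendE R a b n i) le_sum_corner.
have sup0 : 0 <= supnorm R a b n.
  by rewrite /supnorm; elim/big_ind: _ => // u v u0 v0; rewrite le_max u0.
have le_supQ : supnorm R a b n ^+ 2 <= #|{: Gtype a b}|%:R * Qform R a b n.
  apply: (@le_trans _ _ ((\sum_i m i) ^+ 2)); first by rewrite lerXn2r.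
  apply: (le_trans (sqr_sum_le R _ m)).
  by rewrite ler_wpM2l// (le_trans m2).
have [->|G0] := eqVneq #|{: Gtype a b}| 0%N.
  (* With the convention [0^-1 = 0] the left side is 0. *)
  by rewrite invr0 mul0r QB B0.
by rewrite mulrC ler_pdivrMr ?ltr0n ?lt0n// mulrC.
Qed.
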